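(* Let $k$ and $m_1,\dots,m_k$ be positive integers, let $\mathcal R=\prod_{i\in[k]}\mathbb R^{m_i}$, and let $\Gamma\subset\mathcal R$ be a translation-admissible tropical variety of dimension $n$. Then for any $I,J\subset[k]$, $$\dim\pi_{I\cap J}(\Gamma)+\dim\pi_{I\cup J}(\Gamma)\le\dim\pi_I(\Gamma)+\dim\pi_J(\Gamma).$$
   Context: Notation: $[k]=\{1,\dots,k\}$; for $I\subset[k]$, $\pi_I\colon\mathcal R\to\prod_{i\in I}\mathbb R^{m_i}$ is the projection (for $I=\emptyset$ the target is a point); $A+B$ is the Minkowski sum. Each $\mathbb R^m$ carries the lattice $\mathbb Z^m$ (products carry the product lattice). A polyhedral complex in $\mathbb R^m$ is assumed finite, pure-dimensional and rational (each polyhedron is cut out by finitely many inequalities $\langle a,x\rangle\le b$ with $a\in\mathbb Z^m$, $b\in\mathbb R$); its maximal faces are called facets. For a polyhedron $P$, $\mathrm{Lin}(P)$ is the linear subspace of dimension $\dim P$ parallel to $P$. A tropical variety is (an equivalence class, up to refinement, of) a polyhedral complex $\Gamma$ with non-negative integer weights $\omega(P)$ on its facets satisfying the balancing condition at every codimension-1 face $Q$: $\sum_{P\supset Q}\omega(P)\vec v_{P/Q}=0$ in $\mathbb R^m/\mathrm{Lin}(Q)$, where $P$ runs over the facets containing $Q$ and $\vec v_{P/Q}$ is the primitive integer generator of the ray obtained by projecting $P$ to $\mathbb R^m/\mathrm{Lin}(Q)$. Its support is the union of the facets of nonzero weight; $\Gamma$ is identified with its support when convenient (so facets are understood to have positive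 weight). A tropical variety $\Gamma\subset\mathbb R^m$ is translation-admissible if for every rational linear subspace $V$ of $\mathbb R^m$ (one spanned by vectors in $\mathbb Q^m$), the set $\Gamma+V$ is the support of a tropical variety. *)

(* Defs.v *)
From HB Require Import structures.
From mathcomp Require Import all_boot all_order all_algebra.
From mathcomp Require Import all_classical all_reals.

Set Implicit Arguments.
Unset Strict Implicit.
Unset Printing Implicit Defensive.
Import Order.TTheory GRing.Theory Num.Theory.
Local Open Scope classical_set_scope.
Local Open Scope ring_scope.

(* Points of R^m are row vectors; the lattice Z^m is the image of 'rV[int]_m,
   and all subsets of R^m are classical sets. *)
Section Polyhedra.
Context {R : realType} {m : nat}.
Implicit Types P Q F S : set 'rV[R]_m.

Definition halfspaces N (A : 'M[R]_(N, m)) (b : 'cV[R]_N) : set 'rV[R]_m :=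
  [set x | forall i, (A *m x^T) i 0 <= b i 0].

Definition is_polyhedron P : Prop :=
  exists N (A : 'M[R]_(N, m)) (b : 'cV[R]_N), P = halfspaces A b.

Definition is_rational_polyhedron P : Prop :=
  exists N (A : 'M[int]_(N, m)) (b : 'cV[R]_N),
    P = halfspaces (map_mx intr A) b.

(* The empty set may or may not be a face in this sense; only nonempty faces
   are used below. *)
Definition is_face F P : Prop :=
  exists a : 'rV[R]_m,
    F = [set x | P x /\ forall y, P y -> (a *m y^T) 0 0 <= (a *m x^T) 0 0].

Definition contains_differences P (W : {vspace 'rV[R]_m}) : Prop :=
  forall x y, P x -> P y -> x - y \in W.

(* Lin P is the smallest linear subspace containing all x - y with x, y in P
   (see Lin_differences and Lin_min), so that P spans a translate of it. *)
Definition Lin P : {vspace 'rV[R]_m} :=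
  xget 0%VS [set W | contains_differences P W /\
    forall U, contains_differences P U -> (W <= U)%VS].

Lemma Lin_subproof P :
  contains_differences P (Lin P) /\
  forall U, contains_differences P U -> (Lin P <= U)%VS.
Proof.
have exW : exists W, [set W | contains_differences P W /\
    forall U, contains_differences P U -> (W <= U)%VS] W; last first.
  exact: (xgetPex 0%VS exW).
pose p d := `[< exists2 W, contains_differences P W & \dim W = d >].
have exp : exists d, p d.
  exists (\dim {:'rV[R]_m}); apply/asboolP; exists fullv => // x y _ _.
  exact: memvf.
case: (ex_minnP exp) => d /asboolP[W PW dimW] min_d.
exists W; split=> // U PU.
have PWU : contains_differences P (W :&: U)%VS.
  by move=> x y Px Py; rewrite memv_cap PW //= PU.
have le_d : (d <= \dim (W :&: U)%VS)%N.
  by apply: min_d; apply/asboolP; exists (W :&: U)%VS.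
apply: subv_trans (capvSr W U).
have /eqP -> : (W :&: U)%VS == W by rewrite eqEdim capvSl dimW.
exact: subvv.
Qed.

Lemma Lin_differences P : contains_differences P (Lin P).
Proof. exact: (Lin_subproof P).1. Qed.

Lemma Lin_min P U : contains_differences P U -> (Lin P <= U)%VS.
Proof. exact: (Lin_subproof P).2. Qed.

Definition poly_dim P : nat := \dim (Lin P).

(* Dimension of a finite union of polyhedra: the largest dimension of a
   polyhedron that it contains (and 0 for the empty set). *)
Definition set_dim S : nat :=
  (\max_(d < m.+1 | `[< exists P, [/\ is_polyhedron P, P !=set0, P `<=` S
                                    & poly_dim P = d] >]) d)%N.

Definition lattice_pt (z : 'rV[int]_m) : 'rV[R]_m := map_mx intr z.

(* Vectors of R^m / Lin Q are handled through representatives in R^m. When Q is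
   a face of codimension 1 of P, this is the preimage in R^m of the ray spanned
   by the projection of P to R^m / Lin Q (with the image of Q as origin). *)
Definition in_ray P Q : set 'rV[R]_m :=
  [set x | exists s p q, [/\ 0 <= s, P p, Q q & x - s *: (p - q) \in Lin Q]].

(* z represents v_(P/Q): it lies on the ray, and each lattice point of the ray
   is, modulo Lin Q, a natural multiple of z. *)
Definition primitive_generator P Q (z : 'rV[int]_m) : Prop :=
  in_ray P Q (lattice_pt z) /\
  forall w : 'rV[int]_m, in_ray P Q (lattice_pt w) ->
    exists c : nat, lattice_pt w - lattice_pt z *+ c \in Lin Q.

Definition is_facet (C : set (set 'rV[R]_m)) P : Prop :=
  C P /\ forall Q, C Q -> P `<=` Q -> Q = P.

Definition rational_subspace (V : {vspace 'rV[R]_m}) : Prop :=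
  exists s : seq 'rV[rat]_m, V = <<map (map_mx ratr) s>>%VS.

End Polyhedra.

(* A weighted balanced rational polyhedral complex of pure dimension n, with
   cells recorded without the empty face. It represents a tropical variety, that
   is, its class up to refinement. *)
Record tropical_variety (R : realType) (m n : nat) := TropicalVariety {
  cells : set (set 'rV[R]_m);
  weight : set 'rV[R]_m -> nat;
  cells_finite : finite_set cells;
  cells_nonempty : forall P, cells P -> P !=set0;
  cells_rational : forall P, cells P -> is_rational_polyhedron P;
  cells_faces : forall P F, cells P -> is_face F P -> F !=set0 -> cells F;
  cells_meet : forall P Q, cells P -> cells Q -> P `&` Q !=set0 ->
    is_face (P `&` Q) P /\ is_face (P `&` Q) Q;
  cells_pure : forall P, is_facet cells P -> poly_dim P = n;
  cells_balanced : forall Q, cells Q -> (poly_dim Q).+1 = n ->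
    exists2 v : set 'rV[R]_m -> 'rV[int]_m,
      forall P, is_facet cells P -> Q `<=` P -> primitive_generator P Q (v P) &
      \sum_(P \in [set P | is_facet cells P /\ Q `<=` P])
        (lattice_pt (v P) : 'rV[R]_m) *+ weight P \in Lin Q
}.

Definition trop_support (R : realType) (m n : nat)
    (G : tropical_variety R m n) : set 'rV[R]_m :=
  \bigcup_(P in [set P | is_facet (cells G) P /\ (0 < weight G P)%N]) P.

Definition translation_admissible (R : realType) (m n : nat)
    (G : tropical_variety R m n) : Prop :=
  forall V : {vspace 'rV[R]_m}, rational_subspace V ->
    exists n' (G' : tropical_variety R m n'),
      trop_support G' = [set x + v | x in trop_support G & v in [set` V]].

(* The product of the R^(m i), i in [k], is R^(m_1 + ... + m_k), split into
   blocks by submxrow; block_proj I keeps the blocks indexed by I. *)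
Definition block_proj (R : realType) (k : nat) (m : 'I_k -> nat) (I : {set 'I_k})
    (x : 'rV[R]_(\sum_(i < k) m i)) : 'rV[R]_(\sum_(j < #|I|) m (enum_val j)) :=
  \mxrow_(j < #|I|) submxrow x (enum_val j).

(* Main.v *)
From HB Require Import structures.
Require Import Defs.
From mathcomp Require Import all_boot all_order all_algebra.
From mathcomp Require Import all_classical all_reals.
From mathcomp Require Import ring lra zify.
Local Open Scope classical_set_scope.

(** The dimension of the image of the support under a linear map f is the
    largest dim (f (Lin P)), P running over the facets of positive weight
    ([leq_set_dim_image], [set_dim_image_leq]). For one fixed P the function
    I |-> dim (pi_I (Lin P)) is submodular by linear algebra, since the kernels
    of the projections satisfy ker pi_I + ker pi_J <= ker pi_(I :&: J) and
    ker pi_I :&: ker pi_J = ker pi_(I :|: J) ([dim_block_hom_submodular]).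
    What has to be excluded is that the maxima for I :&: J and for I :|: J are
    attained at different facets only: a single facet attaining both suffices,
    because its images bound the dimensions for I and J from below.

    Such a facet comes from translation-admissibility
    ([exists_simultaneous_facet]). Let V be the kernel of pi_(I :|: J) and let P
    be optimal for I :&: J. The set Gamma + V is the support of a tropical
    variety, hence it is pure-dimensional. The convex set P + V is covered by
    finitely many facets of Gamma + V, so one of them, F, has a linear span
    containing Lin P + V. In turn F is covered by the sets Q + V with Q a facet
    of Gamma, so Lin F <= Lin Q + V for some Q. By purity dim F is the dimension
    of Gamma + V, so Q is optimal for I :|: J; and since V lies in the kernel of
    pi_(I :&: J), the inclusion Lin P <= Lin Q + V makes Q optimal for I :&: J
    too.

    The geometric input in all these steps is that a convex set covered by
    finitely many sets spans no more than one of them does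
    ([convex_cover_Lin]). *)

(** * Convex sets, their linear spans and finite covers *)

Section Affine.
Set Implicit Arguments.
Unset Strict Implicit.
Unset Printing Implicit Defensive.
Import Order.TTheory GRing.Theory Num.Theory.
Local Open Scope ring_scope.
Context {R : realType} {m : nat}.
Implicit Types (C P Q S : set 'rV[R]_m) (x y z : 'rV[R]_m).
Implicit Types (V : {vspace 'rV[R]_m}).

Definition is_convex C : Prop :=
  forall x y (t : R), C x -> C y -> 0 <= t -> t <= 1 -> C (x + t *: (y - x)).

Definition translate_sum S V : set 'rV[R]_m :=
  [set x + v | x in S & v in [set` V]].

Lemma LinS P Q : P `<=` Q -> (Lin P <= Lin Q)%VS.
Proof.
by move=> sPQ; apply: Lin_min => x y Px Py; apply: Lin_differences; apply: sPQ.
Qed.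

Lemma Lin_translate_sum P V :
  P !=set0 -> Lin (translate_sum P V) = (Lin P + V)%VS.
Proof.
move=> [p Pp]; apply/eqP; rewrite eqEsubv; apply/andP; split.
  apply: Lin_min => _ _ [x Px [u Vu <-]] [y Py [v Vv <-]].
  rewrite opprD addrACA; apply: memv_add; first exact: Lin_differences.
  exact: memvB.
have PV x u : P x -> u \in V -> translate_sum P V (x + u).
  by move=> Px Vu; exists x => //; exists u.
rewrite subv_add; apply/andP; split.
  apply: LinS => x Px; rewrite -[x]addr0; apply: PV => //; exact: mem0v.
apply/subvP => u Vu; have -> : u = (p + u) - (p + 0) by rewrite addr0 addrC addKr.
by apply: Lin_differences; apply: PV => //; exact: mem0v.
Qed.

Lemma convex_translate_sum P V : is_convex P -> is_convex (translate_sum P V).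
Proof.
move=> cP _ _ t [x Px [u Vu <-]] [y Py [v Vv <-]] t0 t1.
exists (x + t *: (y - x)); first exact: cP.
exists (u + t *: (v - u)).
  by rewrite /= memvD // memvZ // memvB.
by rewrite addrACA -scalerDr addrACA opprD.
Qed.

Lemma polyhedron_convex P : is_polyhedron P -> is_convex P.
Proof.
move=> [N [A [b ->]]] x y t Px Py t0 t1 i.
have := Px i; have := Py i.
rewrite !(linearD, linearZ, linearN) /= !mxE.
set u := \sum_j _; set v := \sum_j _; nra.
Qed.

Lemma rational_is_polyhedron P : is_rational_polyhedron P -> is_polyhedron P.
Proof. by move=> [N [A [b ->]]]; exists N, (map_mx intr A), b. Qed.

Definition affine_hull Q : set 'rV[R]_m :=
  [set x | exists2 q, Q q & x - q \in Lin Q].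

(** Two distinct parameters give two distinct points of the line through x and
    y, unless x = y, where the claim is immediate; the hull then contains the
    whole line. *)
Lemma affine_hull_line Q x y (s t : R) : s != t ->
  affine_hull Q (x + s *: (y - x)) -> affine_hull Q (x + t *: (y - x)) ->
  affine_hull Q x /\ affine_hull Q y.
Proof.
move=> st [p Pp xs] [q Pq xt].
have ts0 : t - s != 0 by rewrite subr_eq0 eq_sym.
have yx : y - x \in Lin Q.
  have -> : y - x = (t - s)^-1 *: ((t - s) *: (y - x)).
    by rewrite scalerA mulVf // scale1r.
  rewrite memvZ //.
  have -> : (t - s) *: (y - x) =
      (x + t *: (y - x) - q) - (x + s *: (y - x) - p) - (p - q).
    by rewrite scalerBl; apply/matrixP => i j; rewrite !mxE; ring.
  by apply: memvB; [exact: memvB | exact: Lin_differences].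
have xp : x - p \in Lin Q.
  by rewrite -[x](addrK (s *: (y - x))) addrAC memvB // memvZ.
split; exists p => //.
by rewrite -[y](subrK x) -addrA memvD.
Qed.

(** An affine subspace that misses some x in C is redundant in the cover: the
    segment from x to any y in C contains more points than there are subspaces,
    so some subspace contains two of them, hence the whole line. It therefore
    contains both y and x, and is not the redundant one. *)
Lemma convex_cover_affine_hull (T : choiceType) (Q : T -> set 'rV[R]_m)
    (s : seq T) C : is_convex C -> C !=set0 ->
  (forall x, C x -> exists2 i, i \in s & affine_hull (Q i) x) ->
  exists2 i, i \in s & C `<=` affine_hull (Q i).
Proof.
move=> cC C0; elim: s => [|i s IHs] cov.
  by have [x /cov[]] := C0.
have [sCi|] := pselect (C `<=` affine_hull (Q i)).
  by exists i => //; exact: mem_head.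
move=> /existsNP[x /not_implyP[Cx Qix]].
suff /IHs [j js sCj] : forall y, C y -> exists2 i, i \in s & affine_hull (Q i) y.
  by exists j => //; rewrite inE js orbT.
move=> y Cy; pose n := (size s).+2; pose tau (j : 'I_n) : R := j.+1%:R^-1.
have tau_inj : injective tau.
  by move=> j k /invr_inj/eqP; rewrite eqr_nat => /eqP[] /val_inj.
have Ctau j : exists k, k \in i :: s /\ affine_hull (Q k) (x + tau j *: (y - x)).
  have [] := cov (x + tau j *: (y - x)); last by move=> k; exists k.
  by apply: cC => //; rewrite /tau ?invr_ge0 ?ler0n ?invf_le1 ?ltr0n ?ler1n.
(* Pigeonhole: n exceeds the number of subspaces in the cover by one. *)
have [f fP] := choice Ctau.
have [j [k jk fjk]] : exists j, exists2 k, j != k & f j = f k.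
  apply/injectivePn/negP => /injectiveP finj.
  suff: (size (map f (enum 'I_n)) <= size (i :: s))%N.
    by rewrite size_map size_enum_ord ltnn.
  apply: uniq_leq_size; first by rewrite map_inj_uniq ?enum_uniq.
  by move=> _ /mapP[j _ ->]; have [] := fP j.
have [fs Qj] := fP j; have [_ Qk] := fP k; rewrite -fjk in Qk.
have [] := affine_hull_line (x := x) (y := y) _ Qj Qk.
  by apply: contraNneq jk => /tau_inj ->.
move=> Qx Qy; exists (f j) => //.
by move: fs Qx; rewrite inE => /orP[/eqP ->|].
Qed.

(** C lies in the affine hull of a single Q i, and the differences of points of
    that hull lie in Lin (Q i). *)
Lemma convex_cover_Lin (T : choiceType) (D : set T) (Q : T -> set 'rV[R]_m) C :
  finite_set D -> is_convex C -> C !=set0 -> C `<=` \bigcup_(i in D) Q i ->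
  exists2 i, D i & (Lin C <= Lin (Q i))%VS.
Proof.
move=> /finite_seqP[s ->] cC C0 cov.
have [|i si sCi] := @convex_cover_affine_hull T Q s C cC C0.
  move=> x /cov[i si Qx]; exists i => //.
  by exists x => //; rewrite subrr mem0v.
exists i => //; apply: Lin_min => x y /sCi[p Qp xp] /sCi[q Qq yq].
have -> : x - y = (x - p) - (y - q) + (p - q).
  by apply/matrixP => a b; rewrite !mxE; ring.
by apply: memvD; [exact: memvB | exact: Lin_differences].
Qed.

(** * Simplices and the dimension of convex sets *)

Lemma polyhedronI P Q :
  is_polyhedron P -> is_polyhedron Q -> is_polyhedron (P `&` Q).
Proof.
move=> [N [A [b ->]]] [N' [A' [b' ->]]].
exists (N + N')%N, (col_mx A A'), (col_mx b b').
apply/seteqP; split => x.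
  move=> [H H'] i; rewrite mul_col_mx; case: (split_ordP i) => j ->.
    by rewrite !col_mxEu.
  by rewrite !col_mxEd.
move=> H; split=> i; [have := H (lshift _ i)|have := H (rshift _ i)].
  by rewrite mul_col_mx !col_mxEu.
by rewrite mul_col_mx !col_mxEd.
Qed.

Lemma polyhedron_mulmx N (M : 'M[R]_(m, N)) (c : 'rV[R]_N) :
  is_polyhedron [set x | forall i, (x *m M) 0 i <= c 0 i].
Proof.
exists N, M^T, c^T; apply/seteqP; split => x /= H i; have := H i;
  by rewrite -trmx_mul !mxE.
Qed.

Definition simplex d y (S : 'M[R]_(d, m)) : set 'rV[R]_m :=
  [set y + t *m S | t in [set t : 'rV[R]_d |
     (forall i, 0 <= t 0 i) /\ \sum_i t 0 i <= 1]].

(** With K a matrix whose columns cut out the row space of S and M a right inverse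
    of S, the point x lies in the simplex when (x - y) K = 0 and the barycentric
    coordinates (x - y) M are nonnegative with sum at most 1. *)
Lemma simplex_polyhedron d y (S : 'M[R]_(d, m)) :
  row_free S -> is_polyhedron (simplex y S).
Proof.
move=> Sfree.
pose le N (M : 'M[R]_(m, N)) (c : 'rV_N) :=
  [set x : 'rV[R]_m | forall i, (x *m M) 0 i <= c 0 i].
have [K SK xK] : exists2 K : 'M_m, S *m K = 0 &
    forall x : 'rV_m, (x <= S)%MS = (x *m K == 0).
  by exists (cokermx S) => [|x]; [exact: mulmx_coker | exact: submxE].
have [M SM xM] : exists2 M : 'M_(m, d), S *m M = 1%:M &
    forall x : 'rV_m, (x <= S)%MS -> x *m M *m S = x.
  by exists (pinvmx S) => [|x]; [exact: mulmxVp | exact: mulmxKpV].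
pose one := const_mx 1 : 'M[R]_(d, 1).
pose tx x := (x - y) *m M.
have -> : simplex y S = (le _ K (y *m K) `&` le _ (- K) (- (y *m K))) `&`
   (le _ (- M) (- (y *m M)) `&` le _ (M *m one) (y *m (M *m one) + const_mx 1)).
  have tsum (t : 'rV[R]_d) i : (t *m one) 0 i = \sum_j t 0 j.
    by rewrite mxE; apply: eq_bigr => j _; rewrite mxE mulr1.
  apply/seteqP; split => x.
    case=> t [t0 t1] <-.
    have yK : (y + t *m S) *m K = y *m K.
      by rewrite mulmxDl -mulmxA SK mulmx0 addr0.
    have yM : (y + t *m S) *m M = y *m M + t.
      by rewrite mulmxDl -mulmxA SM mulmx1.
    split; split => i; rewrite ?mulmxN ?mulmxA ?yK ?yM //.
      by rewrite [leLHS]mxE [leRHS]mxE lerN2 [leRHS]mxE lerDl.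
    by rewrite mulmxDl mxE [leRHS]mxE lerD2l tsum mxE.
  case=> -[H1 H2] [H3 H4].
  have xyS : (x - y <= S)%MS.
    rewrite xK mulmxBl subr_eq0; apply/eqP/rowP => i.
    apply/eqP; rewrite eq_le H1 /=.
    by have := H2 i; rewrite mulmxN [leLHS]mxE [leRHS]mxE lerN2.
  exists (tx x); last by rewrite /tx xM // addrC subrK.
  split=> [i|].
    have := H3 i; rewrite /tx mulmxBl mulmxN [leLHS]mxE [leRHS]mxE lerN2.
    by rewrite [X in _ -> _ <= X]mxE [X in _ -> _ <= _ + X]mxE subr_ge0.
  have := H4 0; rewrite -(tsum _ 0) /tx -mulmxA mulmxBl.
  rewrite [leRHS]mxE [X in _ <= _ + X]mxE.
  by rewrite [X in _ -> X <= _]mxE [X in _ -> _ + X <= _]mxE lerBlDl.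
by do ?apply: polyhedronI; exact: polyhedron_mulmx.
Qed.

Lemma convex_combination C d y (s : 'I_d -> 'rV[R]_m) (t : 'I_d -> R) :
  is_convex C -> C y -> (forall i, C (y + s i)) -> (forall i, 0 <= t i) ->
  \sum_i t i <= 1 -> C (y + \sum_i t i *: s i).
Proof.
move=> cC Cy; elim: d s t => [|d IHd] s t Cs t0 t1.
  by rewrite big_ord0 addr0.
(* Peel off the last vertex: the remaining ones, with weights rescaled by
   1 - r, give a point z of C, and the target lies on the segment from z to
   the last vertex. *)
rewrite big_ord_recr /= in t1; rewrite big_ord_recr /=.
pose r := t ord_max; pose e := widen_ord (leqnSn d); pose w i := t (e i).
have {}t1 : \sum_i w i + r <= 1 := t1.
change (C (y + (\sum_i w i *: s (e i) + r *: s ord_max))).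
have r0 : 0 <= r := t0 _.
have w0 i : 0 <= w i := t0 _.
(* All other weights may vanish, in which case 1 - r may be 0. *)
have [sw0|swN0] := eqVneq (\sum_i w i) 0.
  rewrite big1 => [|i _]; last first.
    by rewrite (psumr_eq0P (fun i _ => w0 i) sw0) ?scale0r.
  rewrite add0r; have -> : y + r *: s ord_max = y + r *: (y + s ord_max - y).
    by rewrite [y + s _]addrC addrK.
  by apply: cC => //; lra.
set c := \sum_i w i in t1 swN0.
have c0 : 0 < c by rewrite lt_neqAle eq_sym swN0 sumr_ge0.
have r1 : 1 - r != 0 by apply: lt0r_neq0; lra.
pose z := y + \sum_(i < d) (w i / (1 - r)) *: s (e i).
have Cz : C z.
  apply: IHd => // [i|]; first by rewrite divr_ge0 //; lra.
  by rewrite -mulr_suml -/c ler_pdivrMr; lra.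
have -> : y + (\sum_i w i *: s (e i) + r *: s ord_max) =
    z + r *: (y + s ord_max - z).
  rewrite (_ : \sum_(i < d) _ = (1 - r) *: (z - y)); last first.
    rewrite /z addrAC subrr add0r scaler_sumr; apply: eq_bigr => i _.
    by rewrite scalerA mulrCA divff // mulr1.
  by apply/matrixP => i j; rewrite !mxE; ring.
by apply: cC => //; lra.
Qed.

(** As long as the vectors chosen so far do not span Lin C, some point of C
    leaves their span, by minimality of Lin C. *)
Lemma convex_frame C y d : C y -> (d <= poly_dim C)%N ->
  exists s : d.-tuple 'rV[R]_m, free s /\ forall i, C (y + tnth s i).
Proof.
move=> Cy; elim: d => [|d IHd] dC.
  by exists [tuple]; split=> [|[]//]; rewrite nil_free.
have [s [sfree Cs]] := IHd (ltnW dC).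
have [x Cx xs] : exists2 x, C x & x - y \notin <<s>>%VS.
  apply: contrapT => H; move: dC; rewrite ltnNge /poly_dim => /negP; apply.
  rewrite -[leqRHS](size_tuple s) -(eqnP sfree) dimvS // Lin_min // => a b Ca Cb.
  have Cin z : C z -> z - y \in <<s>>%VS.
    by move=> Cz; apply: contrapT => /negP zs; apply: H; exists z.
  by have := memvB (Cin _ Ca) (Cin _ Cb); rewrite opprB addrA subrK.
exists [tuple of (x - y) :: s]; split; first by rewrite /= free_cons xs.
by move=> i; case: (unliftP 0 i) => [j|] ->; rewrite ?tnthS // addrC subrK.
Qed.

(** An image of a polyhedron is only known here to be convex, whereas [set_dim]
    measures a set by the polyhedra inside it; this lemma bridges the gap with
    the simplex on a maximal affinely independent family of points of C. *)
Lemma convex_contains_polyhedron C : is_convex C -> C !=set0 ->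
  exists P, [/\ is_polyhedron P, P !=set0, P `<=` C & poly_dim P = poly_dim C].
Proof.
move=> cC [y Cy]; have [s [sfree Cs]] := convex_frame Cy (leqnn _).
pose S := \matrix_i tnth s i.
have tS (t : 'rV_ _) : t *m S = \sum_i t 0 i *: tnth s i.
  by rewrite mulmx_sum_row; apply: eq_bigr => i _; rewrite rowK.
have Sfree : row_free S.
  apply: inj_row_free => t; rewrite tS => ts0.
  apply/rowP => i; rewrite mxE; apply: (freeP sfree (fun i => t 0 i)).
  by rewrite -[RHS]ts0; apply: eq_bigr => j _; rewrite -tnth_nth.
have sSC : simplex y S `<=` C.
  move=> _ [t [t0 t1] <-]; rewrite tS; exact: convex_combination.
have Sy : simplex y S y.
  exists 0; last by rewrite mul0mx addr0.
  split=> [i|]; first by rewrite mxE.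
  by rewrite big1 // => i _; rewrite mxE.
exists (simplex y S); split=> //.
- exact: simplex_polyhedron.
- by exists y.
apply/eqP; rewrite eqn_leq dimvS ?LinS //=.
rewrite -[leqLHS](size_tuple s) -(eqnP sfree) dimvS //.
apply/span_subvP => _ /tnthP[i ->].
have -> : tnth s i = (y + tnth s i) - y by rewrite addrAC subrr add0r.
apply: Lin_differences => //; exists (delta_mx 0 i).
  split=> [j|]; first by rewrite mxE ler0n.
  rewrite (bigD1 i) //= big1 => [|j ji]; rewrite mxE ?eqxx ?addr0 //.
  by rewrite (negPf ji) andbF.
by rewrite -rowE rowK.
Qed.
End Affine.

(** * Dimension of finite unions and of linear images *)

Section Dimension.
Set Implicit Arguments.
Unset Strict Implicit.
Unset Printing Implicit Defensive.
Import Order.TTheory GRing.Theory Num.Theory.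
Local Open Scope ring_scope.
Context {R : realType}.

Lemma exists_argmax (T : Type) (D : set T) (w : T -> nat) b :
  D !=set0 -> (forall i, (w i <= b)%N) ->
  exists2 i, D i & forall j, D j -> (w j <= w i)%N.
Proof.
move=> [i0 Di0] wb; pose p d := `[< exists2 i, D i & w i = d >].
have exp : exists d, p d by exists (w i0); apply/asboolP; exists i0.
have pb d : p d -> (d <= b)%N by move=> /asboolP[i _ <-].
have [d /asboolP[i Di <-] maxd] := ex_maxnP exp pb.
by exists i => // j Dj; apply: maxd; apply/asboolP; exists j.
Qed.

Lemma poly_dim_leq m (P : set 'rV[R]_m) : (poly_dim P <= m)%N.
Proof. by have := dimvS (subvf (Lin P)); rewrite dimvf /dim /= mul1n. Qed.

Lemma leq_set_dim m (C S : set 'rV[R]_m) :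
  is_convex C -> C !=set0 -> C `<=` S -> (poly_dim C <= set_dim S)%N.
Proof.
move=> cC C0 CS; have [P [polP P0 PC <-]] := convex_contains_polyhedron cC C0.
have dP : (poly_dim P < m.+1)%N by rewrite ltnS poly_dim_leq.
apply: (@leq_bigmax_cond _ _ _ (Ordinal dP)).
by apply/asboolP; exists P; split=> //; apply: subset_trans CS.
Qed.

(** Every polyhedron in the union spans no more than one of the Q i, by
    [convex_cover_Lin]. *)
Lemma set_dim_bigcup_leq m (T : choiceType) (D : set T) (Q : T -> set 'rV[R]_m) :
  finite_set D -> D !=set0 ->
  exists2 i, D i & (set_dim (\bigcup_(i in D) Q i) <= poly_dim (Q i))%N.
Proof.
move=> finD D0.
have [i Di maxi] := exists_argmax D0 (fun i => poly_dim_leq (Q i)).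
exists i => //; apply/bigmax_leqP => d /asboolP[P [polP P0 PS <-]].
have [j Dj] := convex_cover_Lin finD (polyhedron_convex polP) P0 PS.
by move=> /dimvS/leq_trans; apply; exact: maxi.
Qed.

Context {a b : nat} (f : 'Hom('rV[R]_a, 'rV[R]_b)).

Lemma convex_image C : is_convex C -> is_convex (f @` C).
Proof.
move=> cC _ _ t [x Cx <-] [y Cy <-] t0 t1.
by exists (x + t *: (y - x)); [exact: cC | rewrite linearD linearZ linearB].
Qed.

Lemma Lin_image P : Lin (f @` P) = (f @: Lin P)%VS.
Proof.
apply/eqP; rewrite eqEsubv; apply/andP; split.
  apply: Lin_min => _ _ [x Px <-] [y Py <-].
  by rewrite -linearB memv_img // Lin_differences.
have sP : (Lin P <= f @^-1: Lin (f @` P))%VS.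
  apply: Lin_min => x y Px Py; rewrite -memv_preim linearB.
  by apply: Lin_differences; [exists x | exists y].
by apply/subvP => _ /memv_imgP[v /(subvP sP) vP ->]; rewrite memv_preim.
Qed.

Lemma dim_addv_lker (L : {vspace 'rV[R]_a}) :
  \dim (L + lker f) = (\dim (lker f) + \dim (f @: L))%N.
Proof.
rewrite -(limg_ker_dim f (L + lker f)%VS) (capv_idPr (addvSr _ _)) limgD.
by have /eqP -> : (f @: lker f == 0)%VS; [rewrite -lkerE | rewrite addv0].
Qed.

Lemma limgS_addv_lker (L L' : {vspace 'rV[R]_a}) V :
  (V <= lker f)%VS -> (L <= L' + V)%VS -> (f @: L <= f @: L')%VS.
Proof.
move=> Vf /(limgS f)/subv_trans; apply; rewrite limgD.
by move: Vf; rewrite lkerE => /eqP ->; rewrite addv0.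
Qed.

End Dimension.

(** * Facets of tropical varieties *)

Section TropicalVarieties.
Set Implicit Arguments.
Unset Strict Implicit.
Unset Printing Implicit Defensive.
Import Order.TTheory GRing.Theory Num.Theory.
Local Open Scope ring_scope.
Context {R : realType} {m : nat}.

Definition support_facets n (G : tropical_variety R m n) : set (set 'rV[R]_m) :=
  [set P | is_facet (cells G) P /\ (0 < weight G P)%N].

Lemma support_facets_finite n (G : tropical_variety R m n) :
  finite_set (support_facets G).
Proof. by apply: sub_finite_set (cells_finite G) => P [[]]. Qed.

Lemma support_facet_nonempty n (G : tropical_variety R m n) P :
  support_facets G P -> P !=set0.
Proof. by move=> [[/cells_nonempty P0 _] _]. Qed.

Lemma support_facet_convex n (G : tropical_variety R m n) P :
  support_facets G P -> is_convex P.
Proof.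
move=> [[/cells_rational ratP _] _].
by apply: polyhedron_convex; exact: rational_is_polyhedron.
Qed.

(** Purity of the translated variety: some facet F of it has Lin P + V inside
    Lin F, and F has the top dimension n'. Covering F back by translated facets of G yields
    a facet P' above P whose translate has the top dimension. *)
Lemma dominating_facet n (G : tropical_variety R m n) n'
    (G' : tropical_variety R m n') V P :
  trop_support G' = translate_sum (trop_support G) V -> support_facets G P ->
  exists P', [/\ support_facets G P', (Lin P <= Lin P' + V)%VS &
    forall Q, support_facets G Q -> (\dim (Lin Q + V) <= \dim (Lin P' + V))%N].
Proof.
move=> eqG'.
have upG' Q : support_facets G Q ->
    exists2 F, support_facets G' F & (Lin Q + V <= Lin F)%VS.
  move=> GQ; have [q Qq] := support_facet_nonempty GQ.
  have [|||F G'F QF] := @convex_cover_Lin _ _ _ (support_facets G') id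
    (translate_sum Q V) (support_facets_finite G').
  - exact: convex_translate_sum (support_facet_convex GQ).
  - by exists (q + 0); exists q => //; exists 0 => //; exact: mem0v.
  - rewrite -/(trop_support G') eqG' => _ [x Qx [v Vv <-]].
    by exists x; [exists Q | exists v].
  - by exists F => //; rewrite -Lin_translate_sum //; exists q.
have downG F : support_facets G' F ->
    exists2 Q, support_facets G Q & (Lin F <= Lin Q + V)%VS.
  move=> G'F; have [|Q GQ FQ] := convex_cover_Lin
    (Q := fun Q => translate_sum Q V) (support_facets_finite G)
    (support_facet_convex G'F) (support_facet_nonempty G'F).
    move=> x Fx; have : trop_support G' x by exists F.
    rewrite eqG' => -[y [Q GQ Qy] [v Vv <-]].
    by exists Q => //; exists y => //; exists v.
  by exists Q => //; rewrite -Lin_translate_sum //;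
    exact: support_facet_nonempty GQ.
move=> GP; have [F G'F PF] := upG' P GP; have [P' GP' FP'] := downG F G'F.
exists P'; split=> //.
  exact: subv_trans (addvSl _ V) (subv_trans PF FP').
move=> Q GQ; have [F' G'F' QF'] := upG' Q GQ.
apply: leq_trans (dimvS QF') (leq_trans _ (dimvS FP')).
have dimF E : support_facets G' E -> \dim (Lin E) = n'.
  by move=> [/cells_pure].
by rewrite !dimF.
Qed.

Lemma leq_set_dim_image n (G : tropical_variety R m n) b
    (f : 'Hom('rV[R]_m, 'rV[R]_b)) P :
  support_facets G P -> (\dim (f @: Lin P) <= set_dim (f @` trop_support G))%N.
Proof.
move=> GP; rewrite -Lin_image; apply: leq_set_dim.
- apply: convex_image; exact: support_facet_convex GP.
- by have [p Pp] := support_facet_nonempty GP; exists (f p), p.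
- by apply: image_subset => x Px; exists P.
Qed.

Lemma set_dim_image_leq n (G : tropical_variety R m n) b
    (f : 'Hom('rV[R]_m, 'rV[R]_b)) :
  trop_support G !=set0 -> exists2 P, support_facets G P &
    (set_dim (f @` trop_support G) <= \dim (f @: Lin P))%N.
Proof.
move=> [x [P GP _]].
have [|Q GQ dimQ] := set_dim_bigcup_leq (fun Q => f @` Q)
  (support_facets_finite G).
  by exists P.
by exists Q; rewrite // -Lin_image /trop_support image_bigcup.
Qed.

(** Translating by the kernel of the finer map g gives a facet that is optimal
    for g, since dim (Lin P + lker g) and dim (g @: Lin P) differ by a constant,
    and that dominates modulo lker g <= lker f a facet optimal for f. *)
Lemma exists_simultaneous_facet n (G : tropical_variety R m n) a b
    (f : 'Hom('rV[R]_m, 'rV[R]_a)) (g : 'Hom('rV[R]_m, 'rV[R]_b)) :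
  translation_admissible G -> rational_subspace (lker g) ->
  (lker g <= lker f)%VS -> trop_support G !=set0 ->
  exists P, [/\ support_facets G P,
    (set_dim (f @` trop_support G) <= \dim (f @: Lin P))%N &
    (set_dim (g @` trop_support G) <= \dim (g @: Lin P))%N].
Proof.
move=> admG /admG[n' [G' eqG']] gf G0.
have [P GP dimP] := set_dim_image_leq f G0.
have [Q GQ dimQ] := set_dim_image_leq g G0.
have [P' [GP' PP' maxP']] := dominating_facet eqG' GP.
exists P'; split=> //.
  exact: leq_trans dimP (dimvS (limgS_addv_lker gf PP')).
apply: leq_trans dimQ _; have := maxP' Q GQ.
by rewrite !dim_addv_lker leq_add2l.
Qed.

End TropicalVarieties.

(** * Block projections *)

Section Blocks.
Set Implicit Arguments.
Unset Strict Implicit.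
Unset Printing Implicit Defensive.
Import Order.TTheory GRing.Theory Num.Theory.
Local Open Scope ring_scope.
Context {R : realType} {k : nat} (m : 'I_k -> nat).
Implicit Types (I J : {set 'I_k}) (L : {vspace 'rV[R]_(\sum_i m i)}).

Lemma block_proj_is_linear I : linear (@block_proj R k m I).
Proof. by move=> c x y; apply/rowP => j; rewrite !mxE. Qed.

HB.instance Definition _ I := GRing.isLinear.Build R _ _ _ (@block_proj R k m I)
  (block_proj_is_linear I).

Definition block_hom I : 'Hom('rV[R]_(\sum_i m i), _) :=
  linfun (@block_proj R k m I).

Lemma block_homE I S : block_hom I @` S = block_proj I @` S.
Proof. by apply: eq_imagel => x _; rewrite lfunE. Qed.

(** The kernel is a coordinate subspace; rationality and the lattice relations
    between kernels are read off from this description. *)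
Lemma memv_lker_block_hom I (x : 'rV[R]_(\sum_i m i)) :
  reflect (forall l, tagnat.sig1 l \in I -> x 0 l = 0) (x \in lker (block_hom I)).
Proof.
rewrite memv_ker lfunE /=; apply: (iffP eqP) => [x0 l lI|x0].
  have xj (j : 'I_#|I|) : submxrow x (enum_val j) = 0.
    have := congr1 (fun y => submxrow y j) x0; rewrite mxrowK => ->.
    by apply/rowP => i; rewrite !mxE.
  have := xj (enum_rank_in lI (tagnat.sig1 l)); rewrite enum_rankK_in //.
  by move=> /rowP/(_ (tagnat.sig2 l)); rewrite !mxE tagnat.sig2K.
by apply/rowP => j; rewrite !mxE x0 // tagnat.Rank1K enum_valP.
Qed.

Lemma rational_lker_block_hom I : rational_subspace (lker (block_hom I)).
Proof.
pose D := [seq delta_mx 0 l : 'rV[rat]_(\sum_i m i) |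
  l <- enum 'I_(\sum_i m i) & tagnat.sig1 l \notin I].
exists D; apply/eqP; rewrite eqEsubv; apply/andP; split.
  apply/subvP => x /memv_lker_block_hom x0.
  rewrite [x]row_sum_delta; apply: memv_suml => l _.
  have [/x0 ->|lI] := boolP (tagnat.sig1 l \in I).
    by rewrite scale0r mem0v.
  rewrite memvZ // memv_span // -map_comp; apply/mapP; exists l.
    by rewrite mem_filter lI mem_enum.
  by apply/rowP => j; rewrite !mxE ratr_nat.
apply/span_subvP => _ /mapP[_ /mapP[l + ->] ->].
rewrite mem_filter => /andP[lI _]; apply/memv_lker_block_hom => j jI.
rewrite !mxE eqxx /=; case: eqVneq => [jl|_]; last by rewrite ratr_nat.
by rewrite -jl jI in lI.
Qed.

Lemma lker_block_homS I J :
  I \subset J -> (lker (block_hom J) <= lker (block_hom I))%VS.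
Proof.
move=> /fintype.subsetP IJ; apply/subvP => x /memv_lker_block_hom x0.
by apply/memv_lker_block_hom => l /IJ; exact: x0.
Qed.

Lemma lker_block_homU I J :
  (lker (block_hom I) :&: lker (block_hom J) <= lker (block_hom (I :|: J)))%VS.
Proof.
apply/subvP => x /memv_capP[/memv_lker_block_hom xI /memv_lker_block_hom xJ].
by apply/memv_lker_block_hom => l /finset.setUP[/xI|/xJ].
Qed.

(** By rank-nullity on L this is the dimension formula for the sum and the
    intersection of the two kernels in L. *)
Lemma dim_block_hom_submodular I J L :
  (\dim (block_hom (I :&: J) @: L) + \dim (block_hom (I :|: J) @: L)
   <= \dim (block_hom I @: L) + \dim (block_hom J @: L))%N.
Proof.
have arith kI kJ kA kB dI dJ dA dB d sum cap :
    (kA + dA = d -> kB + dB = d -> kI + dI = d -> kJ + dJ = d ->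
     sum + cap = kI + kJ -> sum <= kA -> cap <= kB -> dA + dB <= dI + dJ)%N.
  by lia.
apply: arith; try exact: limg_ker_dim; first exact: dimv_sum_cap.
  by rewrite dimvS // subv_add !capvS ?lker_block_homS
    ?finset.subsetIl ?finset.subsetIr.
rewrite dimvS // subv_cap; apply/andP; split.
  exact: subv_trans (capvSl _ _) (capvSl _ _).
by apply: subv_trans (lker_block_homU I J); rewrite capvS ?capvSr.
Qed.

End Blocks.

(** * Submodularity of projection dimensions *)

Theorem proposition3p4 (R : realType) (k : nat) (m : 'I_k -> nat) (n : nat)
    (k_gt0 : (0 < k)%N) (m_gt0 : forall i, (0 < m i)%N)
    (G : tropical_variety R (\sum_(i < k) m i) n)
    (G_adm : translation_admissible G) (I J : {set 'I_k}) :
  (set_dim (block_proj (I :&: J) @` trop_support G) +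
     set_dim (block_proj (I :|: J) @` trop_support G)
   <= set_dim (block_proj I @` trop_support G) +
        set_dim (block_proj J @` trop_support G))%N.
Proof.
have [G0|/set0P G0] := eqVneq (trop_support G) set0.
  have dim0 a : @set_dim R a set0 = 0%N.
    apply/eqP; rewrite -leqn0; apply/bigmax_leqP => d /asboolP[P [_ [x Px] P0 _]].
    by case: (P0 x Px).
  by rewrite G0 !image_set0 !dim0.
rewrite -!block_homE.
have ker_sub : (lker (block_hom (R := R) m (I :|: J)) <=
    lker (block_hom m (I :&: J)))%VS.
  apply: lker_block_homS.
  exact: fintype.subset_trans (finset.subsetIl _ _) (finset.subsetUl _ _).
have [P [GP dimA dimB]] := exists_simultaneous_facet G_adm
  (rational_lker_block_hom _ _) ker_sub G0.
apply: leq_trans (leq_add dimA dimB) _.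
apply: leq_trans (dim_block_hom_submodular _ _ _) _.
by apply: leq_add; apply: leq_set_dim_image.
Qed.
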